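(* Let $\mathcal{M}$ be a Type $\mathcal{B}$ surface. Then $E(0,\nabla)=\operatorname{Span}\{1\}$ except in the following cases, where we also require $\rho_\nabla\neq0$: \begin{enumerate} \item $C_{11}{}^2=c\,C_{11}{}^1$, $C_{12}{}^2=c\,C_{12}{}^1$, $C_{22}{}^2=c\,C_{22}{}^1$ for some $c\in\mathbb{R}$, in which case $E(0,\nabla)=\operatorname{Span}\{1,x^2-cx^1\}$. \item $C_{11}{}^1=-1$, $C_{12}{}^1=0$, $C_{22}{}^1=0$, in which case $E(0,\nabla)=\operatorname{Span}\{1,\log(x^1)\}$. \item $C_{11}{}^1=\alpha-1$, $C_{12}{}^1=0$, $C_{22}{}^1=0$ for some $\alpha\neq0$, in which case $E(0,\nabla)=\operatorname{Span}\{1,(x^1)^\alpha\}$. \end{enumerate}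
   Context: A Type $\mathcal{B}$ surface is $M=\mathbb{R}^+\times\mathbb{R}$ with coordinates $(x^1,x^2)$, $x^1>0$, and a torsion free connection $\nabla$, $\nabla_{\partial_{x^i}}\partial_{x^j}=\Gamma_{ij}{}^k\partial_{x^k}$, with Christoffel symbols $\Gamma_{ij}{}^k=(x^1)^{-1}C_{ij}{}^k$ where $C_{ij}{}^k=C_{ji}{}^k\in\mathbb{R}$ are constants, and which is not flat, i.e. whose Ricci tensor $\rho_\nabla$ does not vanish identically. Here $\rho_\nabla(x,y)=\operatorname{Tr}\{z\mapsto R_\nabla(z,x)y\}$ with $R_\nabla(x,y)=\nabla_x\nabla_y-\nabla_y\nabla_x-\nabla_{[x,y]}$. The Hessian is $\mathcal{H}_\nabla f=(\partial_{x^i}\partial_{x^j}f-\Gamma_{ij}{}^k\partial_{x^k}f)\,dx^i\otimes dx^j$, and $E(0,\nabla)=\{f\in C^\infty(M):\mathcal{H}_\nabla f=0\}$ is the real vector space of Yamabe solitons. *)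

(* Defs.v *)
From Stdlib Require Import Reals List.
From Coquelicot Require Import Coquelicot.
Import ListNotations.
Open Scope R_scope.

Inductive index : Set := i1 | i2.

Definition sum_index (F : index -> R) : R := F i1 + F i2.

Definition delta (i j : index) : R :=
  match i, j with
  | i1, i1 | i2, i2 => 1
  | _, _ => 0
  end.

(* Functions and vector fields on the open half plane [M] are represented by
   total functions of the two coordinates; every condition below is imposed,
   and every equality is tested, only at points of [M]. *)
Definition scalar_field := R -> R -> R.
Definition vector_field := index -> scalar_field.

Definition M (x1 x2 : R) : Prop := 0 < x1.

(* [ex_diff_n f n x1 x2] asserts that [f] is continuous at the point, that its
   first partial derivatives exist there and, recursively, that they satisfy
   the same property with [n - 1].  On an open set this is being of class C^n. *)
Definition smooth (f : scalar_field) : Prop :=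
  forall x1 x2, M x1 x2 -> forall n, ex_diff_n f n x1 x2.

Definition partial (i : index) (f : scalar_field) : scalar_field :=
  match i with
  | i1 => fun x1 x2 => Derive (fun t => f t x2) x1
  | i2 => fun x1 x2 => Derive (fun t => f x1 t) x2
  end.

Definition coord_field (i : index) : vector_field := fun k _ _ => delta i k.

Definition dir_deriv (X : vector_field) (f : scalar_field) : scalar_field :=
  fun x1 x2 => sum_index (fun i => X i x1 x2 * partial i f x1 x2).

Definition bracket (X Y : vector_field) : vector_field :=
  fun k x1 x2 => dir_deriv X (Y k) x1 x2 - dir_deriv Y (X k) x1 x2.

(* A connection is given by its Christoffel symbols:
   [G i j k] is the k-th component of nabla_{d_i} d_j. *)
Definition connection := index -> index -> index -> scalar_field.

Definition nabla (G : connection) (X Y : vector_field) : vector_field :=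
  fun k x1 x2 =>
    dir_deriv X (Y k) x1 x2
    + sum_index (fun i => sum_index (fun j =>
        X i x1 x2 * Y j x1 x2 * G i j k x1 x2)).

Definition curvature (G : connection) (X Y Z : vector_field) : vector_field :=
  fun k x1 x2 =>
    nabla G X (nabla G Y Z) k x1 x2 - nabla G Y (nabla G X Z) k x1 x2
    - nabla G (bracket X Y) Z k x1 x2.

(* The trace of Z |-> R(Z, X) Y, computed in the coordinate frame. *)
Definition ricci (G : connection) (X Y : vector_field) : scalar_field :=
  fun x1 x2 => sum_index (fun k => curvature G (coord_field k) X Y k x1 x2).

(* A tensor vanishes identically iff all its components in the coordinate
   frame do. *)
Definition ricci_vanishes (G : connection) : Prop :=
  forall i j x1 x2, M x1 x2 ->
    ricci G (coord_field i) (coord_field j) x1 x2 = 0.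

Definition typeB_connection (C : index -> index -> index -> R) : connection :=
  fun i j k x1 _ => / x1 * C i j k.

(* Symmetry of [C] in its lower (first two) indices is torsion-freeness. *)
Definition typeB_surface (C : index -> index -> index -> R) : Prop :=
  (forall i j k, C i j k = C j i k) /\ ~ ricci_vanishes (typeB_connection C).

Definition hessian (G : connection) (f : scalar_field) (i j : index)
  : scalar_field :=
  fun x1 x2 =>
    partial i (partial j f) x1 x2
    - sum_index (fun k => G i j k x1 x2 * partial k f x1 x2).

Definition E0 (G : connection) (f : scalar_field) : Prop :=
  smooth f /\ forall i j x1 x2, M x1 x2 -> hessian G f i j x1 x2 = 0.

Definition lin_comb (a : list R) (l : list scalar_field) : scalar_field :=
  fun x1 x2 =>
    fold_right (fun p s => fst p * snd p x1 x2 + s) 0 (combine a l).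

Definition Span (l : list scalar_field) (f : scalar_field) : Prop :=
  exists a : list R, length a = length l /\
    forall x1 x2, M x1 x2 -> f x1 x2 = lin_comb a l x1 x2.

Definition same_space (V W : scalar_field -> Prop) : Prop :=
  forall f, V f <-> W f.

(* Main.v *)
(** Write [u], [v] for the first partial derivatives of a soliton [f].  The
    Hessian equation makes [(u, v)] a solution of a closed linear first order
    system, and equality of the mixed derivatives of [u] and of [v] gives two
    linear relations between [u] and [v], whose coefficients are the components
    of the curvature.  In dimension two these vanish together with the Ricci
    tensor, so some nontrivial relation [A u + B v = 0] with constant
    coefficients holds.  Differentiating it once more at a point where
    [(u, v) <> 0] forces the Christoffel symbols into one of the exceptional
    families; in each of these the relation reads [u = - c v] or [v = 0], and
    the system integrates at once. *)

Require Import Defs.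
From Stdlib Require Import Reals List Lra Lia FunctionalExtensionality Classical.
From Coquelicot Require Import Coquelicot.
Import ListNotations.
Open Scope R_scope.

(** * Calculus on the open half plane: locality, mixed derivatives, functions with zero gradient *)

Lemma locally_pos x : 0 < x -> locally x (fun t => 0 < t).
Proof. exact (open_gt 0 x). Qed.

Lemma locally_2d_M (P : R -> R -> Prop) x y :
  (forall u v, M u v -> P u v) -> M x y -> locally_2d P x y.
Proof.
  intros HP Hx.
  (* The distance from the point to the boundary of [M] is [x] itself, so this radius keeps the
     first coordinate positive. *)
  exists (mkposreal x Hx); simpl; intros u v Hu _.
  apply HP; unfold M in *.
  apply Rabs_def2 in Hu; lra.
Qed.

(** Values outside [M] are arbitrary, so rewriting under a derivative relies on [M] being open. In
    the second direction the whole line lies in [M]. *)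
Lemma partial_ext (i : index) (f g : scalar_field) x y :
  (forall u v, M u v -> f u v = g u v) -> M x y ->
  partial i f x y = partial i g x y.
Proof.
  intros H Hx; destruct i; simpl; apply Derive_ext_loc.
  - generalize (locally_pos x Hx); apply filter_imp; intros t Ht.
    now apply H.
  - apply filter_forall; intros t; now apply H.
Qed.

Lemma smooth_ext (f g : scalar_field) :
  (forall x y, M x y -> f x y = g x y) -> smooth f -> smooth g.
Proof.
  intros H Hf x y Hx n.
  apply (ex_diff_n_ext_loc f); [|now apply Hf].
  now apply locally_2d_M.
Qed.

Lemma smooth_partial (i : index) (f : scalar_field) :
  smooth f -> smooth (partial i f).
Proof.
  intros H x y Hx n; destruct (H x y Hx (S n)) as (_ & _ & _ & H1 & H2).
  now destruct i.
Qed.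

Lemma smooth_continuous (f : scalar_field) x y :
  smooth f -> M x y -> continuity_2d_pt f x y.
Proof. intros H Hx; now destruct (H x y Hx 0%nat). Qed.

Lemma smooth_ex_derive (f : scalar_field) x y :
  smooth f -> M x y ->
  ex_derive (fun t => f t y) x /\ ex_derive (fun t => f x t) y.
Proof.
  intros H Hx; destruct (H x y Hx 1%nat) as (_ & H1 & H2 & _); now split.
Qed.

Lemma smooth_Schwarz (f : scalar_field) x y :
  smooth f -> M x y ->
  partial i1 (partial i2 f) x y = partial i2 (partial i1 f) x y.
Proof.
  intros H Hx.
  apply (Schwarz f x y).
  - apply locally_2d_M; [|exact Hx]; intros u v Hu.
    destruct (smooth_ex_derive f u v H Hu) as [H1 H2].
    split; [exact H1|split; [exact H2|split]].
    + exact (proj1 (smooth_ex_derive _ u v (smooth_partial i2 f H) Hu)).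
    + exact (proj2 (smooth_ex_derive _ u v (smooth_partial i1 f H) Hu)).
  - apply (smooth_continuous (partial i1 (partial i2 f)));
      [now repeat apply smooth_partial|exact Hx].
  - apply (smooth_continuous (partial i2 (partial i1 f)));
      [now repeat apply smooth_partial|exact Hx].
Qed.

Lemma is_derive_0_const (f : R -> R) (a b : R) :
  (forall t, Rmin a b <= t <= Rmax a b -> is_derive f t 0) -> f a = f b.
Proof.
  intros H.
  destruct (MVT_gen f a b (fun _ => 0)) as (c & _ & Hc).
  - intros t Ht; apply H; lra.
  - intros t Ht; apply continuity_pt_filterlim, (ex_derive_continuous f).
    exists 0; now apply H.
  - lra.
Qed.

(** The point is joined to the base point [(1, 0)] by a horizontal and then a vertical segment, both
    inside [M]; the mean value theorem applies on each. *)
Lemma partials_0_const (f : scalar_field) :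
  (forall x y, M x y -> is_derive (fun t => f t y) x 0) ->
  (forall x y, M x y -> is_derive (fun t => f x t) y 0) ->
  forall x y, M x y -> f x y = f 1 0.
Proof.
  intros H1 H2 x y Hx; unfold M in *.
  transitivity (f 1 y).
  - apply (is_derive_0_const (fun t => f t y)); intros t Ht; apply H1.
    apply Rlt_le_trans with (2 := proj1 Ht); apply Rmin_glb_lt; lra.
  - apply (is_derive_0_const (fun t => f 1 t)); intros t Ht; apply H2; lra.
Qed.

(** * Smooth functions of one variable, and affine functions of [x2] *)

Definition smooth_pos (g : R -> R) : Prop :=
  forall n x, 0 < x -> ex_derive_n g n x.

(** Shifts the order of differentiability from [g'] to [g]. As [g'] is the derivative only on the
    positive half line, the iterated derivatives are compared on neighbourhoods. *)
Lemma ex_derive_n_S (g g' : R -> R) (n : nat) :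
  (forall x, 0 < x -> is_derive g x (g' x)) ->
  (forall x, 0 < x -> ex_derive_n g' n x) ->
  forall x, 0 < x -> ex_derive_n g (S n) x.
Proof.
  intros Hg Hn x Hx; destruct n as [|m]; simpl.
  - exists (g' x); now apply Hg.
  - apply ex_derive_ext_loc with (Derive_n g' m); [|now apply Hn].
    generalize (locally_pos x Hx); apply filter_imp; intros t Ht.
    change (Derive (Derive_n g m) t) with (Derive_n g (S m) t).
    replace (S m) with (m + 1)%nat by lia.
    rewrite <- Derive_n_comp.
    apply Derive_n_ext_loc.
    generalize (locally_pos t Ht); apply filter_imp; intros s Hs.
    symmetry; apply is_derive_unique; now apply Hg.
Qed.

Lemma smooth_pos_Derive (g : R -> R) : smooth_pos g -> smooth_pos (Derive g).
Proof.
  intros Hg [|n] x Hx; [exact I|].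
  apply ex_derive_ext with (Derive_n g (S n)); [|now apply (Hg (S (S n)))].
  intros t; replace (S n) with (n + 1)%nat by lia.
  now rewrite <- Derive_n_comp.
Qed.

Lemma is_derive_Rpower (a x : R) :
  0 < x -> is_derive (fun t => Rpower t a) x (a * Rpower x (a - 1)).
Proof.
  intros Hx; apply is_derive_Reals; now apply derivable_pt_lim_power.
Qed.

(** The factor [k] makes the family closed under differentiation, so induction on the order works
    with [k] and [a] both general. *)
Lemma smooth_pos_scal_Rpower (k a : R) : smooth_pos (fun x => k * Rpower x a).
Proof.
  intros n; revert k a; induction n as [|n IH]; intros k a x Hx; [exact I|].
  apply (ex_derive_n_S _ (fun t => (k * a) * Rpower t (a - 1))); [|auto|exact Hx].
  intros t Ht; rewrite Rmult_assoc.
  apply (is_derive_scal (fun t => Rpower t a)); now apply is_derive_Rpower.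
Qed.

Lemma smooth_pos_primitive (g g' : R -> R) :
  (forall x, 0 < x -> is_derive g x (g' x)) -> smooth_pos g' -> smooth_pos g.
Proof.
  intros Hg Hg' [|n] x Hx; [exact I|].
  apply (ex_derive_n_S g g'); auto.
Qed.

Lemma smooth_pos_const (c : R) : smooth_pos (fun _ => c).
Proof. intros n x _; apply ex_derive_n_const. Qed.

(** This class of functions is closed under both partial derivatives: they are again of the form
    [g x + k * y], with slope 0 and with [Derive g] or a constant in place of [g]. Hence the
    induction over all [g] and [k]. *)
Lemma smooth_affine (g : R -> R) (k : R) :
  smooth_pos g -> smooth (fun x y => g x + k * y).
Proof.
  intros Hg x y Hx n; revert g k Hg x y Hx.
  induction n as [|n IH]; intros g k Hg x y Hx.
  all: assert (Hc : continuity_2d_pt (fun x y => g x + k * y) x y) by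
    (apply continuity_2d_pt_plus;
     [ apply (continuity_1d_2d_pt_comp g (fun x _ => x));
       [apply continuity_pt_filterlim, (ex_derive_continuous g), (Hg 1%nat), Hx
       | apply continuity_2d_pt_id1]
     | apply continuity_2d_pt_mult;
       [apply continuity_2d_pt_const | apply continuity_2d_pt_id2]]).
  - now split.
  - assert (Hg1 : forall u, 0 < u -> ex_derive g u) by (intros u; apply (Hg 1%nat)).
    split; [exact Hc|]; repeat split.
    + specialize (Hg1 x Hx); auto_derive; tauto.
    + auto_derive; tauto.
    + apply (ex_diff_n_ext_loc (fun u v => Derive g u + 0 * v)).
      * apply locally_2d_M; [|exact Hx]; intros u v Hu.
        symmetry; apply is_derive_unique; specialize (Hg1 u Hu).
        auto_derive; [tauto|].
        change (fun t => g t) with g; ring.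
      * apply IH; [now apply smooth_pos_Derive|exact Hx].
    + apply (ex_diff_n_ext_loc (fun u v => k + 0 * v)).
      * apply locally_2d_M; [|exact Hx]; intros u v Hu.
        symmetry; apply is_derive_unique; auto_derive; [tauto|ring].
      * apply (IH (fun _ => k)); [apply smooth_pos_const|exact Hx].
Qed.

(** All solitons in the classification have this shape. The gradient is [(g1, k)], and the last
    three hypotheses are the (1,1), (1,2) and (2,2) components of the Hessian equation, cleared of
    [/ x]. *)
Lemma E0_affine (C : index -> index -> index -> R) (f : scalar_field)
    (g g1 g2 : R -> R) (k : R) :
  (forall i j l, C i j l = C j i l) ->
  (forall x y, M x y -> f x y = g x + k * y) ->
  smooth_pos g ->
  (forall x, 0 < x -> is_derive g x (g1 x)) ->
  (forall x, 0 < x -> is_derive g1 x (g2 x)) ->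
  (forall x, 0 < x -> x * g2 x = C i1 i1 i1 * g1 x + C i1 i1 i2 * k) ->
  (forall x, 0 < x -> C i1 i2 i1 * g1 x + C i1 i2 i2 * k = 0) ->
  (forall x, 0 < x -> C i2 i2 i1 * g1 x + C i2 i2 i2 * k = 0) ->
  E0 (typeB_connection C) f.
Proof.
  intros HC Hf Hg Hd1 Hd2 H11 H12 H22.
  assert (P1 : forall x y, M x y -> partial i1 f x y = g1 x).
  { intros x y Hx; rewrite (partial_ext i1 _ _ x y Hf Hx); simpl.
    apply is_derive_unique; specialize (Hd1 x Hx).
    auto_derive; [now exists (g1 x)|].
    change (fun t => g t) with g.
    rewrite (is_derive_unique _ _ _ Hd1); ring. }
  assert (P2 : forall x y, M x y -> partial i2 f x y = k).
  { intros x y Hx; rewrite (partial_ext i2 _ _ x y Hf Hx); simpl.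
    apply is_derive_unique; auto_derive; [tauto|ring]. }
  split.
  - apply (smooth_ext (fun x y => g x + k * y)); [|now apply smooth_affine].
    intros x y Hx; symmetry; now apply Hf.
  - intros i j x y Hx.
    pose proof (H11 x Hx) as E11; pose proof (H12 x Hx) as E12;
      pose proof (H22 x Hx) as E22.
    assert (Hx0 : x <> 0) by (unfold M in Hx; lra).
    unfold hessian, sum_index, typeB_connection.
    rewrite (P1 x y Hx), (P2 x y Hx).
    destruct j.
    + rewrite (partial_ext i _ (fun x _ => g1 x) x y P1 Hx).
      destruct i; simpl.
      * change (fun t => g1 t) with g1.
        rewrite (is_derive_unique _ _ _ (Hd2 x Hx)).
        replace (g2 x) with (/ x * (x * g2 x)) by (field; lra).
        rewrite E11; ring.
      * rewrite Derive_const, !(HC i2 i1).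
        transitivity (- / x * (C i1 i2 i1 * g1 x + C i1 i2 i2 * k)); [ring|].
        rewrite E12; ring.
    + rewrite (partial_ext i _ (fun _ _ => k) x y P2 Hx).
      destruct i; simpl; rewrite Derive_const.
      * transitivity (- / x * (C i1 i2 i1 * g1 x + C i1 i2 i2 * k)); [ring|].
        rewrite E12; ring.
      * transitivity (- / x * (C i2 i2 i1 * g1 x + C i2 i2 i2 * k)); [ring|].
        rewrite E22; ring.
Qed.

(** * Integrability conditions for solitons *)

Lemma is_derive_lin_comb (a b : R) (u v : R -> R) (x du dv : R) :
  is_derive u x du -> is_derive v x dv ->
  is_derive (fun t => a * u t + b * v t) x (a * du + b * dv).
Proof.
  intros Hu Hv; apply (is_derive_plus (fun t => a * u t) (fun t => b * v t));
    now apply is_derive_scal.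
Qed.

Lemma is_derive_inv_mult_lin_comb (a b : R) (u v : R -> R) (x du dv : R) :
  x <> 0 -> is_derive u x du -> is_derive v x dv ->
  is_derive (fun t => / t * (a * u t + b * v t)) x
    (/ x * (a * du + b * dv) - / x * / x * (a * u x + b * v x)).
Proof.
  intros Hx Hu Hv.
  evar_last.
  - apply (is_derive_mult (fun t => / t) (fun t => a * u t + b * v t)).
    + apply is_derive_inv; [apply is_derive_id|exact Hx].
    + apply is_derive_lin_comb; [exact Hu|exact Hv].
    + exact Rmult_comm.
  - unfold plus, mult, one; simpl; field; exact Hx.
Qed.

Lemma E0_second_partials (C : index -> index -> index -> R) (f : scalar_field)
    (i j : index) x y :
  E0 (typeB_connection C) f -> M x y ->
  partial i (partial j f) x y =
  / x * (C i j i1 * partial i1 f x y + C i j i2 * partial i2 f x y).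
Proof.
  intros [_ H] Hx; generalize (H i j x y Hx).
  unfold hessian, sum_index, typeB_connection; intros E; lra.
Qed.

Lemma E0_is_derive_partial (C : index -> index -> index -> R)
    (f : scalar_field) (j : index) x y :
  E0 (typeB_connection C) f -> M x y ->
  is_derive (fun t => partial j f t y) x
    (/ x * (C i1 j i1 * partial i1 f x y + C i1 j i2 * partial i2 f x y)) /\
  is_derive (fun t => partial j f x t) y
    (/ x * (C i2 j i1 * partial i1 f x y + C i2 j i2 * partial i2 f x y)).
Proof.
  intros H Hx; pose proof H as [Hs _].
  destruct (smooth_ex_derive (partial j f) x y) as [D1 D2];
    [now apply smooth_partial|exact Hx|].
  split.
  - rewrite <- (E0_second_partials C f i1 j x y H Hx).
    now apply (Derive_correct (fun t => partial j f t y)).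
  - rewrite <- (E0_second_partials C f i2 j x y H Hx).
    now apply (Derive_correct (fun t => partial j f x t)).
Qed.

(* [curv C j l] is x^2 times the [l]-component of [R(d_1, d_2) d_j]. *)
Definition curv (C : index -> index -> index -> R) (j l : index) : R :=
  - C i2 j l
  + sum_index (fun m => C i2 j m * C i1 m l)
  - sum_index (fun m => C i1 j m * C i2 m l).

(** This is the Ricci identity for the parallel form [df]. The two mixed derivatives of
    [partial j f] agree; evaluating each through the first order system, their difference is the
    left side divided by [x * x]. *)
Lemma E0_curv (C : index -> index -> index -> R) (f : scalar_field)
    (j : index) x y :
  E0 (typeB_connection C) f -> M x y ->
  curv C j i1 * partial i1 f x y + curv C j i2 * partial i2 f x y = 0.
Proof.
  intros H Hx; pose proof H as [Hs _].
  assert (Hx0 : x <> 0) by (unfold M in Hx; lra).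
  assert (E := smooth_Schwarz (partial j f) x y (smooth_partial j f Hs) Hx).
  rewrite (partial_ext i1 _ _ x y
    (fun u v Hu => E0_second_partials C f i2 j u v H Hu) Hx) in E.
  rewrite (partial_ext i2 _ _ x y
    (fun u v Hu => E0_second_partials C f i1 j u v H Hu) Hx) in E.
  destruct (E0_is_derive_partial C f i1 x y H Hx) as [U1 U2].
  destruct (E0_is_derive_partial C f i2 x y H Hx) as [V1 V2].
  simpl in E.
  rewrite (is_derive_unique _ _ _
    (is_derive_inv_mult_lin_comb _ _ _ _ _ _ _ Hx0 U1 V1)) in E.
  rewrite (is_derive_unique _ _ _
    (is_derive_scal _ _ (/ x) _ (is_derive_lin_comb _ _ _ _ _ _ _ U2 V2))) in E.
  simpl in E.
  unfold curv, sum_index.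
  apply (Rmult_eq_reg_l (/ x * / x)); [|apply Rmult_integral_contrapositive;
    split; now apply Rinv_neq_0_compat].
  rewrite Rmult_0_r.
  match type of E with ?l = ?r => transitivity (l - r); [|lra] end.
  simpl; field; exact Hx0.
Qed.

(** * The Ricci tensor of a Type B connection *)

Lemma nabla_coord_field (G : connection) (i : index) (Y : vector_field)
    (k : index) x y :
  nabla G (coord_field i) Y k x y =
  partial i (Y k) x y + sum_index (fun j => Y j x y * G i j k x y).
Proof.
  unfold nabla, dir_deriv, sum_index, coord_field, delta.
  destruct i; ring.
Qed.

Lemma partial_coord_field (i j k : index) x y :
  partial i (coord_field j k) x y = 0.
Proof. destruct i; unfold partial, coord_field; apply Derive_const. Qed.

(** Stated as an equality of vector fields, so that it rewrites the inner [nabla] of an iterated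
    covariant derivative. *)
Lemma nabla_coord_fields (G : connection) (i j : index) :
  nabla G (coord_field i) (coord_field j) = G i j.
Proof.
  extensionality k; extensionality x; extensionality y.
  rewrite nabla_coord_field, partial_coord_field.
  unfold sum_index, coord_field, delta; destruct j; ring.
Qed.

Lemma bracket_coord_fields (i j : index) :
  bracket (coord_field i) (coord_field j) = fun _ _ _ => 0.
Proof.
  extensionality k; extensionality x; extensionality y.
  unfold bracket, dir_deriv, sum_index.
  rewrite !partial_coord_field; ring.
Qed.

Lemma nabla_0 (G : connection) (Z : vector_field) (k : index) x y :
  nabla G (fun _ _ _ => 0) Z k x y = 0.
Proof. unfold nabla, dir_deriv, sum_index; ring. Qed.

Lemma curvature_coord_fields (G : connection) (i j k l : index) x y :
  curvature G (coord_field i) (coord_field j) (coord_field k) l x y =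
  partial i (G j k l) x y + sum_index (fun m => G j k m x y * G i m l x y)
  - (partial j (G i k l) x y
     + sum_index (fun m => G i k m x y * G j m l x y)).
Proof.
  unfold curvature.
  rewrite !nabla_coord_fields, bracket_coord_fields, nabla_0, !nabla_coord_field.
  ring.
Qed.

Lemma partial_typeB (C : index -> index -> index -> R) (i j k l : index) x y :
  M x y ->
  partial i (typeB_connection C j k l) x y = - (delta i i1 * C j k l) / (x * x).
Proof.
  intros Hx; assert (Hx0 : x <> 0) by (unfold M in Hx; lra).
  unfold typeB_connection; destruct i; simpl.
  - apply is_derive_unique; auto_derive; [exact Hx0|field; exact Hx0].
  - rewrite Derive_const; field; exact Hx0.
Qed.

(** Only one term of the trace survives: the one with [k = i] is zero by antisymmetry of the
    curvature. Up to sign and the factor [x * x], the Ricci components are therefore all the numbers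
    [curv C j l]. *)
Lemma ricci_typeB (C : index -> index -> index -> R) (i j : index) x y :
  M x y ->
  ricci (typeB_connection C) (coord_field i) (coord_field j) x y =
  match i with i1 => - curv C j i2 | i2 => curv C j i1 end / (x * x).
Proof.
  intros Hx; assert (Hx0 : x <> 0) by (unfold M in Hx; lra).
  unfold ricci, sum_index at 1.
  rewrite !curvature_coord_fields, !partial_typeB by exact Hx.
  unfold curv, sum_index, typeB_connection, delta.
  destruct i; field; exact Hx0.
Qed.

Lemma typeB_surface_curv (C : index -> index -> index -> R) :
  typeB_surface C -> exists j, curv C j i1 <> 0 \/ curv C j i2 <> 0.
Proof.
  intros [_ HR]; apply NNPP; intros HN; apply HR.
  intros i j x y Hx; rewrite ricci_typeB by exact Hx.
  assert (H1 : curv C j i1 = 0) by (apply NNPP; intros H; apply HN; exists j; tauto).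
  assert (H2 : curv C j i2 = 0) by (apply NNPP; intros H; apply HN; exists j; tauto).
  rewrite H1, H2; unfold Rdiv; destruct i; ring.
Qed.

(** * Solving the soliton equation *)

Lemma Span_single (g f : scalar_field) :
  Span [g] f <-> exists a, forall x y, M x y -> f x y = a * g x y.
Proof.
  unfold Span, lin_comb; split.
  - intros ([|a [|b l]] & Hl & H); try discriminate.
    exists a; intros x y Hx; rewrite (H x y Hx); simpl; ring.
  - intros [a H]; exists [a]; split; [reflexivity|].
    intros x y Hx; rewrite (H x y Hx); simpl; ring.
Qed.

Lemma Span_pair (g h f : scalar_field) :
  Span [g; h] f <->
  exists a b, forall x y, M x y -> f x y = a * g x y + b * h x y.
Proof.
  unfold Span, lin_comb; split.
  - intros ([|a [|b [|c l]]] & Hl & H); try discriminate.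
    exists a, b; intros x y Hx; rewrite (H x y Hx); simpl; ring.
  - intros (a & b & H); exists [a; b]; split; [reflexivity|].
    intros x y Hx; rewrite (H x y Hx); simpl; ring.
Qed.

Lemma E0_is_derive (G : connection) (f : scalar_field) x y :
  E0 G f -> M x y ->
  is_derive (fun t => f t y) x (partial i1 f x y) /\
  is_derive (fun t => f x t) y (partial i2 f x y).
Proof.
  intros [H _] Hx; destruct (smooth_ex_derive f x y H Hx) as [H1 H2].
  split; [apply (Derive_correct (fun t => f t y))
         |apply (Derive_correct (fun t => f x t))]; assumption.
Qed.

(** The difference [f - k * h] has zero gradient. The factor 1 in the conclusion matches the span of
    the constant 1 and [h]. *)
Lemma affine_of_gradient (f h : scalar_field) (u v : scalar_field) (k : R) :
  (forall x y, M x y -> is_derive (fun t => f t y) x (k * u x y) /\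
                        is_derive (fun t => f x t) y (k * v x y)) ->
  (forall x y, M x y -> is_derive (fun t => h t y) x (u x y) /\
                        is_derive (fun t => h x t) y (v x y)) ->
  exists a, forall x y, M x y -> f x y = a * 1 + k * h x y.
Proof.
  intros Hf Hh.
  exists (f 1 0 - k * h 1 0); intros x y Hx.
  enough (E : f x y - k * h x y = f 1 0 - k * h 1 0) by (rewrite <- E; ring).
  apply (partials_0_const (fun x y => f x y - k * h x y)); [| |exact Hx];
    clear x y Hx; intros x y Hx;
    destruct (Hf x y Hx) as [F1 F2], (Hh x y Hx) as [H1 H2].
  - replace 0 with (k * u x y - k * u x y) by ring.
    apply (is_derive_minus (fun t => f t y) (fun t => k * h t y));
      [exact F1|now apply (is_derive_scal (fun t => h t y))].
  - replace 0 with (k * v x y - k * v x y) by ring.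
    apply (is_derive_minus (fun t => f x t) (fun t => k * h x t));
      [exact F2|now apply (is_derive_scal (fun t => h x t))].
Qed.

(** A linear relation with constant coefficients may be differentiated in either direction; the
    system turns the result into another linear relation on the gradient, and the common factor
    [/ x] is dropped. *)
Lemma E0_relation_is_derive (C : index -> index -> index -> R)
    (f : scalar_field) (A B : R) :
  E0 (typeB_connection C) f ->
  (forall x y, M x y -> A * partial i1 f x y + B * partial i2 f x y = 0) ->
  forall i x y, M x y ->
  A * (C i i1 i1 * partial i1 f x y + C i i1 i2 * partial i2 f x y)
  + B * (C i i2 i1 * partial i1 f x y + C i i2 i2 * partial i2 f x y) = 0.
Proof.
  intros H HR i x y Hx.
  apply (Rmult_eq_reg_l (/ x)); [|apply Rinv_neq_0_compat, Rgt_not_eq, Hx].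
  transitivity (A * partial i (partial i1 f) x y
                + B * partial i (partial i2 f) x y).
  { rewrite !(E0_second_partials C f _ _ x y H Hx); ring. }
  transitivity (partial i (fun _ _ => 0) x y).
  2: { destruct i; simpl; rewrite Derive_const; ring. }
  rewrite <- (partial_ext i _ _ x y HR Hx).
  destruct (E0_is_derive_partial C f i1 x y H Hx) as [U1 U2].
  destruct (E0_is_derive_partial C f i2 x y H Hx) as [V1 V2].
  symmetry; destruct i; apply is_derive_unique.
  - rewrite !(E0_second_partials C f _ _ x y H Hx).
    now apply is_derive_lin_comb.
  - rewrite !(E0_second_partials C f _ _ x y H Hx).
    now apply is_derive_lin_comb.
Qed.

(* The second and third alternatives come from [v <> 0] and from [v = 0],
   [u <> 0]; in the former case [c = - u / v]. *)
Lemma E0_gradient_exceptional (C : index -> index -> index -> R)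
    (f : scalar_field) x y :
  typeB_surface C -> E0 (typeB_connection C) f -> M x y ->
  (partial i1 f x y = 0 /\ partial i2 f x y = 0) \/
  (exists c, C i1 i1 i2 = c * C i1 i1 i1 /\
             C i1 i2 i2 = c * C i1 i2 i1 /\
             C i2 i2 i2 = c * C i2 i2 i1) \/
  (C i1 i2 i1 = 0 /\ C i2 i2 i1 = 0).
Proof.
  intros HS H Hx; pose proof HS as [HC _].
  destruct (typeB_surface_curv C HS) as [j Hj].
  set (A := curv C j i1) in *; set (B := curv C j i2) in *.
  assert (HR : forall x y, M x y ->
    A * partial i1 f x y + B * partial i2 f x y = 0)
    by (intros u v Hu; now apply E0_curv).
  assert (H0 := HR x y Hx).
  assert (H1 := E0_relation_is_derive C f A B H HR i1 x y Hx).
  assert (H2 := E0_relation_is_derive C f A B H HR i2 x y Hx).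
  assert (H3 := E0_curv C f i2 x y H Hx).
  (* From here on the argument is algebra in real numbers at a single point: the relation, its two
     derivatives and the curvature relation for the second frame field. *)
  clearbody A B; clear HR.
  unfold curv, sum_index in H3; rewrite !(HC i2 i1) in *.
  revert H0 H1 H2 H3.
  generalize (partial i1 f x y) (partial i2 f x y); intros u v.
  generalize (C i1 i1 i1) (C i1 i1 i2) (C i1 i2 i1) (C i1 i2 i2)
    (C i2 i2 i1) (C i2 i2 i2); intros a p b q e r H0 H1 H2 H3.
  destruct (Req_dec v 0) as [Hv|Hv].
  - destruct (Req_dec u 0) as [Hu|Hu]; [tauto|right; right].
    subst v.
    assert (HA : A = 0) by (apply (Rmult_eq_reg_r u); lra).
    subst A.
    assert (HB : B <> 0) by tauto.
    assert (Hb : B * u <> 0) by (apply Rmult_integral_contrapositive; tauto).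
    split; apply (Rmult_eq_reg_l (B * u)); trivial; lra.
  - right; left; exists (- u / v).
    assert (Eu : u = - (- u / v) * v) by (field; exact Hv).
    set (c := - u / v) in *; clearbody c; subst u.
    assert (EB : B = A * c) by (apply (Rmult_eq_reg_r v); lra).
    subst B.
    assert (HA : A <> 0) by (intros E; rewrite E, Rmult_0_l in Hj; tauto).
    assert (HAv : A * v <> 0) by (apply Rmult_integral_contrapositive; tauto).
    (* With [u = - c * v] and [B = A * c], the differentiated relations factor through [A * v]. *)
    assert (K1 : p - c * a + c * (q - c * b) = 0)
      by (apply (Rmult_eq_reg_l (A * v)); trivial; lra).
    assert (K2 : q - c * b + c * (r - c * e) = 0)
      by (apply (Rmult_eq_reg_l (A * v)); trivial; lra).
    (* Put [X = p - c * a], [Y = q - c * b], [Z = r - c * e]. Then [H3] says [v * (- Z + e * X + r *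
       Y - b * Y - q * Z) = 0]. Substituting [Y = - c * Z] and [X = - c * Y] cancels everything
       except [- v * Z]. *)
    assert (K3 : r - c * e = 0).
    { apply (Rmult_eq_reg_l v); trivial.
      assert (Eq : q = c * b - c * (r - c * e)) by lra.
      assert (Ep : p = c * a - c * (q - c * b)) by lra.
      rewrite Eq in Ep; rewrite Ep, Eq in H3; lra. }
    rewrite K3, Rmult_0_r in K2.
    replace (q - c * b) with 0 in K1 by lra.
    repeat split; lra.
Qed.

(** * The solution spaces in the generic and in the exceptional cases *)

Lemma E0_const (C : index -> index -> index -> R) (f : scalar_field) (a : R) :
  (forall i j l, C i j l = C j i l) ->
  (forall x y, M x y -> f x y = a) -> E0 (typeB_connection C) f.
Proof.
  intros HC Hf.
  apply (E0_affine C f (fun _ => a) (fun _ => 0) (fun _ => 0) 0 HC);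
    try (intros; ring).
  - intros x y Hx; rewrite (Hf x y Hx); ring.
  - apply smooth_pos_const.
  - intros; apply (is_derive_const a).
  - intros; apply (is_derive_const 0).
Qed.

Lemma E0_generic (C : index -> index -> index -> R) :
  typeB_surface C ->
  ~ (exists c, C i1 i1 i2 = c * C i1 i1 i1 /\
               C i1 i2 i2 = c * C i1 i2 i1 /\
               C i2 i2 i2 = c * C i2 i2 i1) ->
  ~ (C i1 i2 i1 = 0 /\ C i2 i2 i1 = 0) ->
  same_space (E0 (typeB_connection C)) (Span [fun _ _ => 1]).
Proof.
  intros HS N1 N2 f; rewrite Span_single; split.
  - intros H; exists (f 1 0); intros x y Hx; rewrite Rmult_1_r.
    apply (partials_0_const f); [| |exact Hx]; clear x y Hx; intros x y Hx;
      destruct (E0_is_derive _ f x y H Hx) as [D1 D2];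
      destruct (E0_gradient_exceptional C f x y HS H Hx) as [[E1 E2]|[E|E]];
      try tauto.
    + now rewrite <- E1.
    + now rewrite <- E2.
  - intros [a Ha]; apply (E0_const C f a); [apply HS|].
    intros x y Hx; rewrite (Ha x y Hx); ring.
Qed.

(** Proportional Christoffel symbols give [curv C j i2 = c * curv C j i1], so non-flatness yields
    [u = - c * v]. Both derivatives of [v] are multiples of [u + c * v], hence [v] is constant. *)
Lemma E0_proportional (C : index -> index -> index -> R) (c : R) :
  typeB_surface C ->
  C i1 i1 i2 = c * C i1 i1 i1 ->
  C i1 i2 i2 = c * C i1 i2 i1 ->
  C i2 i2 i2 = c * C i2 i2 i1 ->
  same_space (E0 (typeB_connection C))
    (Span [(fun _ _ => 1); (fun x1 x2 => x2 - c * x1)]).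
Proof.
  intros HS E11 E12 E22 f; pose proof HS as [HC _].
  rewrite Span_pair; split.
  - intros H.
    assert (EU : forall x y, M x y ->
      partial i1 f x y = - c * partial i2 f x y).
    { intros x y Hx.
      destruct (typeB_surface_curv C HS) as [j Hj].
      assert (EC : curv C j i2 = c * curv C j i1).
      { unfold curv, sum_index.
        destruct j; rewrite !(HC i2 i1), E11, E12, E22; ring. }
      assert (Hj1 : curv C j i1 <> 0)
        by (intros E; rewrite EC, E, Rmult_0_r in Hj; tauto).
      generalize (E0_curv C f j x y H Hx); rewrite EC; intros E.
      apply (Rmult_eq_reg_l (curv C j i1)); trivial; lra. }
    assert (EV : forall x y, M x y -> partial i2 f x y = partial i2 f 1 0).
    { apply (partials_0_const (partial i2 f)); intros x y Hx;
        destruct (E0_is_derive_partial C f i2 x y H Hx) as [D1 D2].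
      - rewrite (EU x y Hx), E12 in D1.
        replace 0 with (/ x * (C i1 i2 i1 * (- c * partial i2 f x y)
          + c * C i1 i2 i1 * partial i2 f x y)) by ring; exact D1.
      - rewrite (EU x y Hx), E22 in D2.
        replace 0 with (/ x * (C i2 i2 i1 * (- c * partial i2 f x y)
          + c * C i2 i2 i1 * partial i2 f x y)) by ring; exact D2. }
    destruct (affine_of_gradient f (fun x1 x2 => x2 - c * x1)
      (fun _ _ => - c) (fun _ _ => 1) (partial i2 f 1 0)) as [a Ha].
    + intros x y Hx; destruct (E0_is_derive _ f x y H Hx) as [D1 D2].
      rewrite (EU x y Hx), (EV x y Hx) in D1; rewrite (EV x y Hx) in D2.
      split; [rewrite (Rmult_comm _ (- c))|rewrite Rmult_1_r]; assumption.
    + intros x y _; split; auto_derive; trivial; ring.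
    + now exists a, (partial i2 f 1 0).
  - intros (a & b & Hf).
    apply (E0_affine C f (fun x => a - b * c * x) (fun _ => - b * c)
      (fun _ => 0) b HC).
    + intros x y Hx; rewrite (Hf x y Hx); ring.
    + apply smooth_pos_primitive with (fun _ => - b * c).
      * intros x _; auto_derive; trivial; ring.
      * apply smooth_pos_const.
    + intros x _; auto_derive; trivial; ring.
    + intros x _; apply (is_derive_const (- b * c)).
    + intros x _; rewrite E11; ring.
    + intros x _; rewrite E12; ring.
    + intros x _; rewrite E22; ring.
Qed.

(* When [C_{12}^1 = C_{22}^1 = 0], the gradient of a soliton is [(u, 0)] with
   [x u_x = C_{11}^1 u], so [u] is a multiple of a power of [x]. *)
Lemma E0_power (C : index -> index -> index -> R) (h : R -> R) (k : R) :
  typeB_surface C -> C i1 i2 i1 = 0 -> C i2 i2 i1 = 0 -> k <> 0 ->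
  (forall x, 0 < x -> is_derive h x (k * Rpower x (C i1 i1 i1))) ->
  same_space (E0 (typeB_connection C))
    (Span [(fun _ _ => 1); (fun x1 _ => h x1)]).
Proof.
  intros HS Eb Ee Hk Hh f; pose proof HS as [HC _].
  set (al := C i1 i1 i1) in *.
  rewrite Span_pair; split.
  - intros H.
    assert (EV : forall x y, M x y -> partial i2 f x y = 0).
    { intros x y Hx.
      destruct (typeB_surface_curv C HS) as [j Hj].
      (* The first curvature coefficient vanishes for this family, so non-flatness makes the second
         one nonzero and forces [v = 0]. *)
      assert (EC : curv C j i1 = 0).
      { unfold curv, sum_index.
        destruct j; rewrite !(HC i2 i1), Eb, Ee; ring. }
      generalize (E0_curv C f j x y H Hx); rewrite EC in Hj |- *; intros E.
      apply (Rmult_eq_reg_l (curv C j i2)); [lra|tauto]. }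
    (* The product of [u] with the integrating factor [Rpower x (- al)] is a first integral. *)
    assert (EU : forall x y, M x y ->
      partial i1 f x y * Rpower x (- al)
      = partial i1 f 1 0 * Rpower 1 (- al)).
    { apply (partials_0_const (fun x y => partial i1 f x y * Rpower x (- al)));
        intros x y Hx;
        destruct (E0_is_derive_partial C f i1 x y H Hx) as [D1 D2].
      - assert (D3 := is_derive_Rpower (- al) x Hx).
        assert (D := is_derive_mult _ _ _ _ _ D1 D3 Rmult_comm).
        replace 0 with (/ x * (C i1 i1 i1 * partial i1 f x y
          + C i1 i1 i2 * partial i2 f x y) * Rpower x (- al)
          + partial i1 f x y * (- al * Rpower x (- al - 1))); [exact D|].
        fold al; rewrite (EV x y Hx).
        replace (Rpower x (- al - 1)) with (Rpower x (- al) * / x).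
        + ring.
        + unfold Rminus; rewrite Rpower_plus, (Rpower_Ropp x 1), Rpower_1;
            [reflexivity|exact Hx].
      - rewrite (HC i2 i1 i1), Eb, (EV x y Hx) in D2.
        replace 0 with (Rpower x (- al) * (/ x * (0 * partial i1 f x y
          + C i2 i1 i2 * 0))) by ring.
        apply is_derive_ext with
          (fun t => Rpower x (- al) * partial i1 f x t); [intros; apply Rmult_comm|].
        now apply (is_derive_scal (fun t => partial i1 f x t)). }
    set (K := partial i1 f 1 0 * Rpower 1 (- al)) in EU.
    (* Since [u] is [K * Rpower x al] and the derivative of [h] is [k * Rpower x al], the
       coefficient of [h] must be [K / k]. *)
    destruct (affine_of_gradient f (fun x1 _ => h x1)
      (fun x1 _ => k * Rpower x1 al) (fun _ _ => 0) (K / k)) as [a Ha].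
    + intros x y Hx; destruct (E0_is_derive _ f x y H Hx) as [D1 D2].
      rewrite (EV x y Hx) in D2.
      split; [|now rewrite Rmult_0_r].
      replace (K / k * (k * Rpower x al)) with (partial i1 f x y); [exact D1|].
      rewrite <- (EU x y Hx).
      transitivity (partial i1 f x y * (Rpower x (- al) * Rpower x al)).
      * rewrite <- Rpower_plus, Rplus_opp_l, Rpower_O; [ring|exact Hx].
      * field; exact Hk.
    + intros x y Hx; split; [now apply Hh|apply (is_derive_const (h x))].
    + now exists a, (K / k).
  - intros (a & b & Hf).
    assert (D1 : forall x, 0 < x ->
      is_derive (fun x => a + b * h x) x (b * k * Rpower x al)).
    { intros x Hx; rewrite Rmult_assoc.
      rewrite <- (Rplus_0_l (b * _)).
      apply (is_derive_plus (fun _ => a) (fun x => b * h x)).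
      - apply (is_derive_const a).
      - apply (is_derive_scal h); now apply Hh. }
    apply (E0_affine C f (fun x => a + b * h x) (fun x => b * k * Rpower x al)
      (fun x => b * k * (al * Rpower x (al - 1))) 0 HC).
    + intros x y Hx; rewrite (Hf x y Hx); ring.
    + apply smooth_pos_primitive with (1 := D1).
      apply smooth_pos_scal_Rpower.
    + exact D1.
    + intros x Hx; apply (is_derive_scal (fun x => Rpower x al)).
      now apply is_derive_Rpower.
    + intros x Hx; fold al.
      replace (Rpower x al) with (Rpower x (al - 1) * x); [ring|].
      rewrite <- (Rpower_1 x Hx) at 2; rewrite <- Rpower_plus; f_equal; ring.
    + intros x _; rewrite Eb; ring.
    + intros x _; rewrite Ee; ring.
Qed.

Theorem theorem1p14 (C : index -> index -> index -> R) (HC : typeB_surface C) :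
  ((~ (exists c : R, C i1 i1 i2 = c * C i1 i1 i1 /\
                     C i1 i2 i2 = c * C i1 i2 i1 /\
                     C i2 i2 i2 = c * C i2 i2 i1)) ->
   ~ (C i1 i1 i1 = -1 /\ C i1 i2 i1 = 0 /\ C i2 i2 i1 = 0) ->
   ~ (exists alpha : R, alpha <> 0 /\ C i1 i1 i1 = alpha - 1 /\
                        C i1 i2 i1 = 0 /\ C i2 i2 i1 = 0) ->
   same_space (E0 (typeB_connection C)) (Span [fun _ _ => 1]))
  /\
  (forall c : R,
     C i1 i1 i2 = c * C i1 i1 i1 ->
     C i1 i2 i2 = c * C i1 i2 i1 ->
     C i2 i2 i2 = c * C i2 i2 i1 ->
     same_space (E0 (typeB_connection C))
                (Span [(fun _ _ => 1); (fun x1 x2 => x2 - c * x1)]))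
  /\
  (C i1 i1 i1 = -1 -> C i1 i2 i1 = 0 -> C i2 i2 i1 = 0 ->
   same_space (E0 (typeB_connection C))
              (Span [(fun _ _ => 1); (fun x1 _ => ln x1)]))
  /\
  (forall alpha : R, alpha <> 0 ->
     C i1 i1 i1 = alpha - 1 -> C i1 i2 i1 = 0 -> C i2 i2 i1 = 0 ->
     same_space (E0 (typeB_connection C))
                (Span [(fun _ _ => 1); (fun x1 _ => Rpower x1 alpha)])).
Proof.
  split; [|split; [|split]].
  - intros N1 N2 N3; apply E0_generic; trivial.
    intros [Hb He].
    destruct (Req_dec (C i1 i1 i1) (-1)) as [Ha|Ha]; [tauto|].
    (* The logarithmic and power families together exhaust the case of vanishing [C i1 i2 i1] and
       [C i2 i2 i1]: the exponent [C i1 i1 i1 + 1] is zero exactly in the logarithmic one. *)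
    apply N3; exists (C i1 i1 i1 + 1).
    split; [lra|split; [lra|tauto]].
  - intros c; now apply E0_proportional.
  (* The derivative of [ln] is [Rpower x (-1)], whence the factor 1; for the power function below
     the factor is [alpha], nonzero by hypothesis. *)
  - intros Ha Hb He; apply (E0_power C ln 1); trivial; try lra.
    intros x Hx; rewrite Ha, Rmult_1_l.
    replace (-1) with (- (1)) by lra.
    rewrite Rpower_Ropp, Rpower_1 by exact Hx; now apply is_derive_ln.
  - intros alpha Hal Ha Hb He.
    apply (E0_power C (fun x => Rpower x alpha) alpha); trivial.
    intros x Hx; rewrite Ha; now apply is_derive_Rpower.
Qed.
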